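(* Let $M$ be a $d\times n$ unimodular matrix of full row rank $d$, and let $L = M M^{\top}$. Then the following three numbers are equal: the volume of the zonotope $Z(M)\subset\mathbb{R}^d$, the volume of the zonotope $Z(L)\subset\mathbb{R}^d$, and the product $\lambda_1\cdots\lambda_d$ of the eigenvalues (counted with multiplicity) of $L$.
   Context: A $d\times n$ integer matrix $M$ of full row rank $d$ is unimodular if all of its maximal ($d\times d$) minors lie in $\{-1,0,1\}$. For a real matrix $A$ with columns $A_1,\dots,A_k\in\mathbb{R}^d$, the zonotope generated by $A$ is the Minkowski sum of segments $Z(A)=\sum_{i=1}^k \operatorname{conv}\{0,A_i\}=\{\sum_{i=1}^k t_iA_i : t_i\in[0,1]\}$. Volume is $d$-dimensional Euclidean (Lebesgue) volume in $\mathbb{R}^d$. *)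

(* Defs.v *)
From HB Require Import structures.
From mathcomp Require Import all_boot all_order all_algebra.
From mathcomp Require Import all_classical all_reals all_analysis.

Set Implicit Arguments.
Unset Strict Implicit.
Unset Printing Implicit Defensive.

Import Order.TTheory GRing.Theory Num.Theory.

Local Open Scope classical_set_scope.
Local Open Scope ring_scope.

(* A maximal minor is selected by a strictly increasing choice of d column
   indices. The rank is taken over the rationals. *)
Definition unimodular d n (M : 'M[int]_(d, n)) : Prop :=
  \rank (map_mx (intr : int -> rat) M) = d /\
  forall f : 'I_d -> 'I_n, {homo f : i j / (i < j)%N} ->
    \det (colsub f M) \in [:: -1; 0; 1].

Definition zonotope (R : realType) d k (A : 'M[R]_(d, k)) : set 'cV[R]_d :=
  [set v | exists2 t : 'I_k -> R, (forall i, 0 <= t i <= 1) &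
                                  v = \sum_i t i *: col i A].

(* Algebraic multiplicity: each eigenvalue is listed as often as it is a root
   of the characteristic polynomial, which must split over F. *)
Definition eigenvalues_with_multiplicity (F : fieldType) d
    (A : 'M[F]_d) (lambda : d.-tuple F) : Prop :=
  char_poly A = \prod_(a <- lambda) ('X - a%:P).

Lemma mem_eigenvalues (F : fieldType) d (A : 'M[F]_d) (lambda : d.-tuple F) :
  eigenvalues_with_multiplicity A lambda ->
  forall a, (a \in lambda) = eigenvalue A a.
Proof.
by move=> Alambda a; rewrite eigenvalue_root_char Alambda root_prod_XsubC.
Qed.

Definition cons_pair T n (p : T * n.-tuple T) : n.+1.-tuple T :=
  [the n.+1.-tuple T of p.1 :: p.2].

Lemma measurable_cons_pair disp (T : measurableType disp) n :
  measurable_fun [set: T * n.-tuple T] (@cons_pair T n).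
Proof. exact: (measurable_cons measurable_fst measurable_snd). Qed.

(* The library's sigma-finite instance on products is shadowed by the one for
   subprobabilities, hence this explicit lemma. *)
Lemma sigma_finite_product d1 d2 (T1 : measurableType d1)
    (T2 : measurableType d2) (R : realType)
    (m1 : {sigma_finite_measure set T1 -> \bar R})
    (m2 : {sigma_finite_measure set T2 -> \bar R}) :
  sigma_finite [set: T1 * T2] (m1 \x m2)%E.
Proof.
have /sigma_finiteP[F [TF ndF Foo]] := sigma_finiteT m1.
have /sigma_finiteP[G [TG ndG Goo]] := sigma_finiteT m2.
exists (fun n => F n `*` G n).
  rewrite -setXTT TF TG; apply/seteqP; split=> -[x y] /=.
    move=> [[n _ Fnx] [k _ Gky]]; exists (maxn n k) => //; split.
    - by move: x Fnx; exact/subsetPset/ndF/leq_maxl.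
    - by move: y Gky; exact/subsetPset/ndG/leq_maxr.
  by move=> [n _ []]; split; exists n.
move=> k; have [mF Fk] := Foo k; have [mG Gk] := Goo k.
split; first exact: measurableX.
by rewrite product_measure1E// lte_mul_pinfty// ge0_fin_numE.
Qed.

Section cons_measure.
Local Open Scope ereal_scope.
Context disp (T : measurableType disp) (R : realType) (n : nat).
Variable mu : {sigma_finite_measure set T -> \bar R}.
Variable m : {sigma_finite_measure set (n.-tuple T) -> \bar R}.

Definition cons_measure : set (n.+1.-tuple T) -> \bar R :=
  pushforward (mu \x m) (@cons_pair T n).

Let cons_measure0 : cons_measure set0 = 0.
Proof. by rewrite /cons_measure /pushforward preimage_set0 measure0. Qed.

Let cons_measure_ge0 A : 0 <= cons_measure A.
Proof. by rewrite /cons_measure /pushforward measure_ge0. Qed.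

Let cons_measure_additive : semi_sigma_additive cons_measure.
Proof.
move=> F mF tF mUF; rewrite /cons_measure /pushforward preimage_bigcup.
apply: measure_semi_sigma_additive.
- by move=> k; rewrite -[X in measurable X]setTI; exact: measurable_cons_pair.
- apply/trivIsetP => /= i j _ _ ij; rewrite -preimage_setI.
  by move/trivIsetP : tF => /(_ _ _ _ _ ij) ->//; rewrite preimage_set0.
- rewrite -preimage_bigcup -[X in measurable X]setTI.
  exact: measurable_cons_pair.
Qed.

HB.instance Definition _ := isMeasure.Build _ _ _ cons_measure
  cons_measure0 cons_measure_ge0 cons_measure_additive.

Let cons_measure_sigma_finite : sigma_finite setT cons_measure.
Proof.
have [F TF Foo] := sigma_finite_product mu m.
pose g (t : n.+1.-tuple T) : T * n.-tuple T := (thead t, [tuple of behead t]).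
have cK : cancel (@cons_pair T n) g.
  by case=> x t; rewrite /g theadE; congr pair; apply/val_inj.
have mg : measurable_fun [set: n.+1.-tuple T] g.
  apply/measurable_fun_pair; first exact: measurable_tnth.
  exact: measurable_behead.
exists (fun k => g @^-1` F k); first by rewrite -preimage_bigcup -TF preimage_setT.
move=> k; have [mF Fk] := Foo k; split.
  by rewrite -[X in measurable X]setTI; exact: mg.
rewrite /cons_measure /pushforward -comp_preimage.
by rewrite (_ : g \o _ = id) //; apply/funext => p /=; rewrite cK.
Qed.

HB.instance Definition _ := Measure_isSigmaFinite.Build _ _ _ cons_measure
  cons_measure_sigma_finite.

End cons_measure.

(* Lebesgue measure on the Borel sets of R^n: the n-fold product of the
   one-dimensional Lebesgue measure. *)
Fixpoint lebesgue_tuple (R : realType) (n : nat) :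
    {sigma_finite_measure set (n.-tuple (measurableTypeR R)) -> \bar R} :=
  match n with
  | 0 => dirac [tuple]
  | n'.+1 => cons_measure lebesgue_measure (lebesgue_tuple R n')
  end.

Lemma lebesgue_tuple_box (R : realType) n (a b : 'I_n -> R) :
  (forall i, a i <= b i) ->
  lebesgue_tuple R n [set t | forall i, tnth t i \in `[a i, b i]] =
    (\prod_i (b i - a i))%:E.
Proof.
elim: n a b => [|n IHn] a b leab.
  by rewrite big_ord0 /= diracE mem_set//= => -[].
set B := fun i : 'I_n.+1 => [set` `[a i, b i]] : set (measurableTypeR R).
pose C : set (n.-tuple (measurableTypeR R)) :=
  [set t | forall i, tnth t i \in `[a (lift ord0 i), b (lift ord0 i)]].
have mC : measurable C.
  rewrite (_ : C = \bigcap_(i in [set: 'I_n])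
      ((fun t : n.-tuple (measurableTypeR R) => tnth t i) @^-1`
        B (lift ord0 i))).
    apply: fin_bigcap_measurable => // i _; rewrite -[X in measurable X]setTI.
    by apply: measurable_tnth => //; exact: measurable_itv.
  by apply/seteqP; split=> [t Ct i _|t Ct i]; [exact: Ct|exact: (Ct i I)].
rewrite /= /cons_measure /pushforward.
rewrite (_ : _ @^-1` _ = B ord0 `*` C); last first.
  apply/seteqP; split=> [[x t] /= H|[x t] /= [H1 H2] i].
    split=> [|i]; first exact: (H ord0).
    by move: (H (lift ord0 i)); rewrite tnthS.
  case: (unliftP ord0 i) => [j|] ->; last exact: H1.
  by rewrite tnthS; exact: H2.
rewrite product_measure1E//; last exact: measurable_itv.
rewrite big_ord_recl EFinM; congr (_ * _)%E; last exact: IHn.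
transitivity (lebesgue_measure ([set` `[a ord0, b ord0]] : set R)) => //.
rewrite lebesgue_measure_itv /= lte_fin -EFinB.
by case: ltgtP (leab ord0) => // ->; rewrite subrr.
Qed.

(* The value is meaningful for A corresponding to a Borel set of tuples (e.g. A
   compact); for other A it is an unspecified value of the iterated integral. *)
Definition volume (R : realType) d (A : set 'cV[R]_d) : \bar R :=
  lebesgue_tuple R d [set t | A (\col_i tnth t i)].

(* Main.v *)
(* Every matrix A over R satisfies vol Z(A) = W(A) / d!, where W(A) is the sum
   of |det A_f| over all maps f from rows to columns (each maximal minor is
   counted d! times). Both sides are multiplied by |det P| when A is replaced
   by PA, and shears of one coordinate against the others together with
   scalings of that coordinate move any nonzero column to e_0. If column j of A
   is e_0, then by Fubini along the first axis
     vol Z(A) = vol Z(A with column j zeroed) + vol Z(A without row 0),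
   because adding the segment [0, e_0] lengthens each nonempty section, which
   is an interval, by 1; measurability holds because a zonotope is a polyhedron
   by Fourier-Motzkin elimination. Laplace expansion gives the same
   recurrence for W.
   For unimodular M the minors satisfy |det| = det^2, so Cauchy-Binet gives
   vol Z(M) = det L; and W(L) = |det L| W(1) with the identity unimodular, so
   vol Z(L) = |det L| = det L as well. *)

Require Import Defs.
From mathcomp Require Import all_boot all_order all_algebra.
From mathcomp Require Import all_classical all_reals all_analysis.
From mathcomp Require Import perm complex measurable_realfun ring lra.

Set Implicit Arguments.
Unset Strict Implicit.
Unset Printing Implicit Defensive.

Import Order.TTheory GRing.Theory Num.Theory.

Local Open Scope classical_set_scope.
Local Open Scope ring_scope.

(** * Maximal minors *)

Lemma colsub_mulmx (R : comNzRingType) m d n p (P : 'M[R]_(m, d))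
    (A : 'M[R]_(d, n)) (f : 'I_p -> 'I_n) :
  colsub f (P *m A) = P *m colsub f A.
Proof.
by apply/matrixP => i j; rewrite !mxE; apply: eq_bigr => k _; rewrite !mxE.
Qed.

Lemma det_colsub_perm (R : comNzRingType) d n (A : 'M[R]_(d, n))
    (f : 'I_d -> 'I_n) (s : 'S_d) :
  \det (colsub (f \o s) A) = (-1) ^+ s * \det (colsub f A).
Proof.
rewrite mulrC -odd_permV -det_perm -det_mulmx -col_permE.
by congr (\det _); apply/matrixP => i j; rewrite !mxE.
Qed.

Lemma det_colsub_noninj (R : comNzRingType) d n (A : 'M[R]_(d, n))
    (f : 'I_d -> 'I_n) : ~~ injectiveb f -> \det (colsub f A) = 0.
Proof.
case/injectivePn => i [j ij fij].
rewrite -det_tr; apply: (determinant_alternate ij) => k.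
by rewrite !mxE fij.
Qed.

Lemma det_colsub1 (R : comNzRingType) d (f : 'I_d -> 'I_d) :
  \det (colsub f (1%:M : 'M[R]_d)) \in [:: -1; 0; 1].
Proof.
have [/injectiveP finj|/det_colsub_noninj->] := boolP (injectiveb f);
  last by rewrite !inE eqxx orbT.
have -> : colsub f 1%:M = colsub (id \o perm finj) 1%:M :> 'M[R]_d.
  by apply/matrixP => i j; rewrite !mxE /= permE.
rewrite det_colsub_perm (_ : colsub id 1%:M = 1%:M); last first.
  by apply/matrixP => i j; rewrite !mxE.
by rewrite det1 mulr1; case: (odd_perm _);
  rewrite ?expr1 ?expr0 !inE eqxx ?orbT.
Qed.

(* Cauchy-Binet; summing over all maps instead of increasing ones repeats
   every term d! times. *)
Lemma sum_det_colsub (R : comNzRingType) d n (A B : 'M[R]_(d, n)) :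
  \sum_(f : {ffun 'I_d -> 'I_n}) \det (colsub f A) * \det (colsub f B) =
  \det (A *m B^T) *+ d`!.
Proof.
(* In each Leibniz term of [\det (A *m B^T)] the product of sums is expanded over all choices [f] of
   summation indices. *)
have detE : \sum_(f : {ffun 'I_d -> 'I_n})
    \det (colsub f A) * \prod_i B i (f i) = \det (A *m B^T).
  under eq_bigr do rewrite -det_tr big_distrl /=.
  rewrite -[RHS]det_tr exchange_big; apply: eq_bigr => s _ /=.
  under [in RHS]eq_bigr => i _ do rewrite !mxE.
  rewrite bigA_distr_bigA /= big_distrr /=; apply: eq_bigr => f _.
  rewrite -mulrA -big_split /=; congr (_ * _); apply: eq_bigr => i _.
  by rewrite !mxE.
(* Each permutation [s] in the Leibniz expansion of the second determinant contributes
   [\det (A *m B^T)]: reindexing [f] by [s] produces the sign of [s] once more, and the two signs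
   cancel. *)
transitivity (\sum_(s : 'S_d) \det (A *m B^T)); last first.
  by rewrite sumr_const card_Sn.
under eq_bigr do rewrite [X in _ * X]/determinant big_distrr /=.
rewrite exchange_big; apply: eq_bigr => s _ /=; rewrite -detE.
rewrite (reindex (fun f : {ffun 'I_d -> 'I_n} => [ffun i => f (s^-1 i)%g])) /=;
  last first.
  exists (fun f : {ffun 'I_d -> 'I_n} => [ffun i => f (s i)]) => f _;
    by apply/ffunP => i; rewrite !ffunE ?permK ?permKV.
apply: eq_bigr => f _.
have -> : \det (colsub [ffun i => f (s^-1 i)%g] A) =
    (-1) ^+ s * \det (colsub f A).
  rewrite -odd_permV -det_colsub_perm; congr (\det _).
  by apply/matrixP => i j; rewrite !mxE ffunE.
rewrite mulrCA !mulrA -signr_addb addbb mul1r; congr (_ * _).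
by apply: eq_bigr => i _; rewrite !mxE ffunE permK.
Qed.

(** This is the quantity W(A) of the overview. *)
Definition minor_sum (R : numDomainType) d n (A : 'M[R]_(d, n)) : R :=
  \sum_(f : {ffun 'I_d -> 'I_n}) `|\det (colsub f A)|.

Lemma minor_sum_ge0 (R : numDomainType) d n (A : 'M[R]_(d, n)) :
  0 <= minor_sum A.
Proof. exact: sumr_ge0. Qed.

Lemma minor_sum_mulmx (R : numDomainType) d n (P : 'M[R]_d) (A : 'M[R]_(d, n)) :
  minor_sum (P *m A) = `|\det P| * minor_sum A.
Proof.
by rewrite mulr_sumr; apply: eq_bigr => f _;
  rewrite colsub_mulmx det_mulmx normrM.
Qed.

Lemma minor_sum_unimodular (R : numDomainType) d n (A : 'M[R]_(d, n)) :
  (forall f : 'I_d -> 'I_n, \det (colsub f A) \in [:: -1; 0; 1]) ->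
  minor_sum A = \det (A *m A^T) * d`!%:R.
Proof.
move=> uA; rewrite mulr_natr -sum_det_colsub; apply: eq_bigr => f _.
move: (uA f); rewrite !inE => /or3P[] /eqP->.
- by rewrite normrN1 mulrNN mulr1.
- by rewrite normr0 mulr0.
- by rewrite normr1 mulr1.
Qed.

(** Zeroing a column instead of deleting it keeps the type of the matrix, which suits induction on
    the number of nonzero columns. *)
Definition zero_col (R : pzRingType) d n (j : 'I_n) (A : 'M[R]_(d, n)) :=
  \matrix_(i, k) if k == j then 0 else A i k.

(** A map [f] that avoids [j] selects the same minor from both matrices. If [f i = j], the minor of
    [zero_col j A] vanishes, and Laplace expansion along column [i] turns that of [A] into a minor
    of [row' 0 A]. There are d + 1 positions [i]. *)
Lemma minor_sum_zero_col (R : numDomainType) d n (A : 'M[R]_(d.+1, n)) j :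
  col j A = delta_mx 0 0 ->
  minor_sum A = minor_sum (zero_col j A) + minor_sum (row' 0 A) *+ d.+1.
Proof.
move=> Aj.
have Aij i : A i j = (i == 0)%:R.
  by have /matrixP/(_ i 0) := Aj; rewrite !mxE eqxx andbT.
have hit i : \sum_(f : {ffun 'I_d.+1 -> 'I_n} | f i == j)
    `|\det (colsub f A)| = minor_sum (row' 0 A).
  (* [h] inserts the value [j] at position [i] and [h'] drops that position: a bijection between the
     maps with [f i = j] and the maps on d positions. *)
  pose h (g : {ffun 'I_d -> 'I_n}) : {ffun 'I_d.+1 -> 'I_n} :=
    [ffun k => if unlift i k is Some l then g l else j].
  pose h' (f : {ffun 'I_d.+1 -> 'I_n}) : {ffun 'I_d -> 'I_n} :=
    [ffun l => f (lift i l)].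
  rewrite (reindex_onto h h') /=; last first.
    move=> f /eqP fij; apply/ffunP => k; rewrite !ffunE.
    by case: unliftP => [l ->|->] //; rewrite ffunE.
  apply: eq_big => [g|g _].
    rewrite ffunE unlift_none eqxx /=; apply/eqP/ffunP => l.
    by rewrite !ffunE liftK.
  rewrite (expand_det_col _ i) (bigD1 0) //= big1 ?addr0 => [|k k0].
    rewrite !mxE ffunE unlift_none Aij eqxx mul1r /cofactor normrM.
    rewrite normrX normrN1 expr1n mul1r; congr (`|\det _|).
    by apply/matrixP => a b; rewrite !mxE ffunE liftK.
  by rewrite !mxE ffunE unlift_none Aij (negPf k0) mul0r.
have -> : minor_sum (row' 0 A) *+ d.+1 = \sum_(i < d.+1)
    \sum_(f : {ffun 'I_d.+1 -> 'I_n} | f i == j) `|\det (colsub f A)|.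
  by under eq_bigr do rewrite hit; rewrite sumr_const card_ord.
rewrite (eq_bigr _ (fun i _ => big_mkcond _ _)) exchange_big /= -big_split /=.
apply: eq_bigr => f _; rewrite -big_mkcond /=.
have [/existsP[i /eqP fij]|] := boolP [exists i, f i == j]; last first.
  rewrite negb_exists => /forallP fj.
  rewrite [X in _ + X]big1 ?addr0 => [|i /eqP fij]; last first.
    by have := fj i; rewrite fij eqxx.
  by congr (`|\det _|); apply/matrixP => a b; rewrite !mxE (negPf (fj b)).
have -> : \det (colsub f (zero_col j A)) = 0.
  rewrite (expand_det_col _ i) big1 // => k _.
  by rewrite !mxE fij eqxx mul0r.
rewrite normr0 add0r.
(* An injective [f] takes the value [j] only once, so the sum over positions has a single term; for
   the other [f] every term is 0. *)
have [/injectiveP finj|fninj] := boolP (injectiveb f); last first.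
  by rewrite det_colsub_noninj // normr0 big1.
by rewrite (big_pred1 i) // => k; rewrite -fij (inj_eq finj).
Qed.

Lemma minor_sum0 (R : numDomainType) d n :
  minor_sum (0 : 'M[R]_(d, n)) = (d == 0%N)%:R.
Proof.
rewrite /minor_sum; case: d => [|d].
  under eq_bigr do rewrite det_mx00 normr1.
  by rewrite sumr_const card_ffun !card_ord expn0.
rewrite big1 // => f _; rewrite (_ : colsub _ _ = 0) ?det0 ?normr0 //.
by apply/matrixP => i j; rewrite !mxE.
Qed.

(** [s] sorts the values of [f]; injectivity makes the sorted list strictly increasing. *)
Lemma increasing_perm d n (f : 'I_d -> 'I_n) : injective f ->
  exists s : 'S_d, {homo f \o s : i j / (i < j)%N}.
Proof.
move=> finj; pose t := [tuple (f i : nat) | i < d].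
have /tuple_permP[s ts] : perm_eq (sort leq t) t by rewrite perm_sort.
exists s => i j ij /=.
have : sorted ltn (sort leq t).
  rewrite ltn_sorted_uniq_leq sort_uniq (sort_sorted leq_total) andbT.
  by rewrite map_inj_uniq ?enum_uniq // => k l /val_inj/finj.
rewrite ts => /(sorted_ltn_nth ltn_trans 0%N) /(_ i j).
rewrite !inE !size_tuple !ltn_ord => /(_ isT isT ij).
by rewrite -!tnth_nth !tnth_mktuple.
Qed.

(** A repeated column gives 0, and an injective map becomes increasing after a permutation, which
    changes at most the sign of the minor. *)
Lemma det_colsub_unimodular (R : comNzRingType) d n (M : 'M[R]_(d, n)) :
  (forall f : 'I_d -> 'I_n, {homo f : i j / (i < j)%N} ->
     \det (colsub f M) \in [:: -1; 0; 1]) ->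
  forall f : 'I_d -> 'I_n, \det (colsub f M) \in [:: -1; 0; 1].
Proof.
move=> uM f; have [/injectiveP finj|/det_colsub_noninj->] :=
  boolP (injectiveb f); last by rewrite !inE eqxx orbT.
have [s /uM] := increasing_perm finj; rewrite det_colsub_perm mulr_sign;
  case: ifP => // _.
by rewrite !inE => /or3P[] /eqP H;
  rewrite -[\det _]opprK H ?opprK ?oppr0 eqxx ?orbT.
Qed.

(** * Real eigenvalues *)

(** The scalar matrix ['X] commutes with constant matrices, so the characteristic matrices are
    conjugate too. *)
Lemma char_poly_similar (F : fieldType) n (P A : 'M[F]_n) : P \in unitmx ->
  char_poly (invmx P *m A *m P) = char_poly A.
Proof.
move=> Pu; have PK : map_mx polyC (invmx P) *m map_mx polyC P = 1%:M.
  by rewrite -map_mxM mulVmx // map_mx1.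
rewrite /char_poly /char_poly_mx !map_mxM.
rewrite -[X in X - _]mulmx1 -PK mulmxA -scalar_mxC -mulmxBl -mulmxBr !det_mulmx.
by rewrite mulrAC -det_mulmx PK det1 mul1r.
Qed.

(** Over [R[i]] the matrix is Hermitian, so the spectral theorem diagonalises it with real entries;
    the factorisation descends to [R] because [toC] is injective. *)
Lemma char_poly_symmetric_split (R : rcfType) d (A : 'M[R]_d) : A^T = A ->
  exists lambda : d.-tuple R, char_poly A = \prod_(a <- lambda) ('X - a%:P).
Proof.
move=> At; pose toC : {rmorphism R -> R[i]%C} := real_complex R.
have hermA : map_mx toC A \is hermsymmx.
  apply: realsym_hermsym.
    apply/is_hermitianmxP; rewrite expr0 scale1r -[in LHS]At.
    by apply/matrixP => i j; rewrite !mxE.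
  by apply/mxOverP => i j; rewrite mxE; apply/complex_realP; exists (A i j).
pose sp := spectral_diag (map_mx toC A).
have spR i : sp 0 i = toC (complex.Re (sp 0 i)).
  by apply/esym/RRe_real; exact: (mxOverP (hermitian_spectral_diag_real hermA)).
exists [tuple complex.Re (sp 0 i) | i < d].
apply: (map_poly_inj toC); rewrite map_char_poly.
have /orthomx_spectralP-> := hermitian_normalmx hermA.
rewrite char_poly_similar ?spectral_unit // char_poly_trig ?diag_mx_is_trig //.
rewrite big_map big_enum rmorph_prod /=; apply: eq_bigr => i _.
by rewrite map_polyXsubC /= -spR mxE eqxx.
Qed.

(** * Volume under linear maps *)

(** Measurability is read off on tuples, through the same identification as in [volume]. *)
Definition measurable_cV (R : realType) d (S : set 'cV[R]_d) :=
  measurable [set t : d.-tuple (measurableTypeR R) | S (\col_i tnth t i)].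

Lemma measurable_cV_affine (R : realType) d e (P : 'M[R]_(d, e)) (w : 'cV_d)
    (S : set 'cV_d) :
  measurable_cV S -> measurable_cV [set v | S (P *m v + w)].
Proof.
move=> mS; pose g (t : e.-tuple (measurableTypeR R)) :
  d.-tuple (measurableTypeR R) :=
    [tuple (P *m (\col_i tnth t i) + w) i 0 | i < d].
have mg : measurable_fun setT g.
  apply/measurable_fun_tnthP => i.
  rewrite (_ : _ \o _ = fun t => \sum_j P i j * tnth t j + w i 0).
    apply: measurable_funD; last exact: measurable_cst.
    apply: measurable_sum => j; apply: measurable_funM;
      first exact: measurable_cst.
    exact: measurable_tnth.
  apply/funext => t /=; rewrite tnth_mktuple !mxE; congr (_ + _).
  by apply: eq_bigr => j _; rewrite !mxE.
rewrite /measurable_cV -[X in measurable X]setTI.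
rewrite (_ : [set _ | _] = g @^-1` [set t | S (\col_i tnth t i)]);
  first exact: mg.
apply/seteqP; split=> t /=; congr S; apply/matrixP => i j;
  by rewrite mxE tnth_mktuple ord1.
Qed.

(** The dimension [1 + d] gives access to block matrices and is convertible with the [d.+1] of
    tuples. *)
Definition cons_cV (R : realType) d (x : R) (y : 'cV[R]_d) : 'cV_(1 + d) :=
  col_mx x%:M y.

Lemma col_cons_pair (R : realType) d (p : R * d.-tuple R) :
  \col_i tnth (cons_pair p) i = cons_cV p.1 (\col_i tnth p.2 i) :> 'cV_(1 + d).
Proof.
apply/matrixP => i j; rewrite !mxE; case: splitP => k ik.
  by rewrite !mxE !ord1 (_ : i = ord0) // ; apply/val_inj; rewrite /= ik ord1.
rewrite (_ : i = lift ord0 k) ?tnthS ?mxE//.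
by apply/val_inj; rewrite /= ik.
Qed.

Lemma measurable_cV_pair (R : realType) d (S : set 'cV[R]_(1 + d)) :
  measurable_cV S ->
  measurable [set p : measurableTypeR R * d.-tuple (measurableTypeR R) |
    S (cons_cV p.1 (\col_i tnth p.2 i))].
Proof.
move=> mS; rewrite -[X in measurable X]setTI.
rewrite (_ : [set _ | _] = @cons_pair _ d @^-1` [set t | S (\col_i tnth t i)]).
  exact: measurable_cons_pair.
by apply/seteqP; split=> p /=; rewrite col_cons_pair.
Qed.

Lemma volumeE (R : realType) d (S : set 'cV[R]_(1 + d)) :
  volume S = (lebesgue_measure \x lebesgue_tuple R d)%E
    [set p : measurableTypeR R * d.-tuple (measurableTypeR R) |
       S (cons_cV p.1 (\col_i tnth p.2 i))].
Proof.
rewrite /volume /= /cons_measure /pushforward; congr (product_measure1 _ _ _).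
by apply/seteqP; split=> p /=; rewrite col_cons_pair.
Qed.

Lemma volume_xsection (R : realType) d (S : set 'cV[R]_(1 + d)) :
  volume S = (\int[lebesgue_measure]_(x in [set: measurableTypeR R])
    volume [set y | S (cons_cV x y)])%E.
Proof.
rewrite volumeE; apply: eq_integral => x _ /=; rewrite /volume;
  congr (lebesgue_tuple _ _ _).
by apply/seteqP; split=> t; rewrite /xsection /= in_setE.
Qed.

(** The two orders of integration define measures that agree on rectangles, hence on all measurable
    sets. *)
Lemma volume_ysection (R : realType) d (S : set 'cV[R]_(1 + d)) :
  measurable_cV S ->
  volume S = (\int[lebesgue_tuple R d]_t
    lebesgue_measure
      [set x : measurableTypeR R | S (cons_cV x (\col_i tnth t i))])%E.
Proof.
move=> /measurable_cV_pair mS; rewrite volumeE.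
transitivity ((lebesgue_measure \x^ lebesgue_tuple R d)%E
    [set p : measurableTypeR R * d.-tuple (measurableTypeR R) |
       S (cons_cV p.1 (\col_i tnth p.2 i))]).
  by apply: product_measure_unique => //= A B mA mB; rewrite product_measure2E.
apply: eq_integral => t _ /=; congr (lebesgue_measure _).
by apply/seteqP; split=> x; rewrite /ysection /= in_setE.
Qed.

(** By uniqueness of Lebesgue measure it suffices to compare both sides on half-open intervals. *)
Lemma lebesgue_measure_affine (R : realType) (c w : R)
    (A : set (measurableTypeR R)) : c != 0 -> measurable A ->
  lebesgue_measure A =
  (`|c|%:E * lebesgue_measure [set x | A (c * x + w)%R])%E.
Proof.
move=> c0 mA.
pose f (x : measurableTypeR R) : measurableTypeR R := c * x + w.
have mf : measurable_fun setT f.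
  by apply: measurable_funD => //; apply: measurable_funM.
rewrite (lebesgue_measure_unique
  (mu := mscale (NngNum (normr_ge0 c)) (pushforward lebesgue_measure f))) //.
move=> _ [[a b]] _ <-.
rewrite /= /mscale /= /pushforward lebesgue_measure_itv /= lte_fin.
have [cp|cn|c00] := ltgtP 0 c; last by rewrite -c00 eqxx in c0.
  rewrite (_ : _ @^-1` _ = [set` `](a - w) / c, (b - w) / c]]); last first.
    by apply/seteqP; split=> x; rewrite /f /= !in_itv /=
      ltr_pdivrMr // ler_pdivlMr // ltrBlDr lerBrDr mulrC.
  rewrite lebesgue_measure_itv /= lte_fin ltr_pM2r ?invr_gt0// ltrD2r.
  case: ifP => _; last by rewrite mule0.
  by rewrite -EFinB -EFinM gtr0_norm //; congr EFin; field.
(* A negative [c] reverses the interval, so the closed end moves to the left. *)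
rewrite (_ : _ @^-1` _ = [set` `[(b - w) / c, (a - w) / c[]); last first.
  by apply/seteqP; split=> x; rewrite /f /= !in_itv /=
    ltr_ndivlMr // ler_ndivrMr // ltrBlDr lerBrDr mulrC andbC.
rewrite lebesgue_measure_itv /= lte_fin ltr_nM2r ?invr_lt0// ltrD2r.
case: ifP => _; last by rewrite mule0.
by rewrite -EFinB -EFinM ltr0_norm //; congr EFin; field.
Qed.

Lemma measurable_xsection_cV (R : realType) d (S : set 'cV[R]_(1 + d)) x :
  measurable_cV S -> measurable_cV [set y | S (cons_cV x y)].
Proof.
move=> /measurable_cV_pair /(measurable_xsection x); rewrite /measurable_cV.
by congr measurable; apply/seteqP; split=> t; rewrite /xsection /= in_setE.
Qed.

Lemma measurable_ysection_cV (R : realType) d (S : set 'cV[R]_(1 + d))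
    (y : 'cV_d) :
  measurable_cV S ->
  measurable [set x : measurableTypeR R | S (cons_cV x y)].
Proof.
move=> /measurable_cV_pair /(measurable_ysection [tuple y i 0 | i < d]).
congr measurable; apply/seteqP; split=> x; rewrite /ysection /= in_setE /=;
  congr (S (cons_cV _ _)); apply/matrixP => i j;
  by rewrite mxE tnth_mktuple ord1.
Qed.

Lemma measurable_fun_ysection_cV (R : realType) d (S : set 'cV[R]_(1 + d)) :
  measurable_cV S ->
  measurable_fun [set: d.-tuple (measurableTypeR R)] (fun t =>
    lebesgue_measure
      [set x : measurableTypeR R | S (cons_cV x (\col_i tnth t i))]).
Proof.
move=> /measurable_cV_pair /(measurable_fun_ysection (@lebesgue_measure R)).
apply: eq_measurable_fun => t _ /=; congr (lebesgue_measure _).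
by apply/seteqP; split=> x; rewrite /ysection /= in_setE.
Qed.

Lemma cons_cVD (R : realType) d (x a : R) (y b : 'cV_d) :
  cons_cV x y + cons_cV a b = cons_cV (x + a) (y + b).
Proof. by rewrite /cons_cV add_col_mx raddfD. Qed.

Lemma upper_cons_cV (R : realType) d (c a x : R) (phi : 'rV_d) (y : 'cV_d) :
  block_mx c%:M phi 0 1%:M *m cons_cV x y + cons_cV a 0 =
  cons_cV (c * x + ((phi *m y) 0 0 + a)) y.
Proof.
rewrite /cons_cV mul_block_col mul0mx add0r mul1mx -scalar_mxM add_col_mx addr0.
by rewrite [in LHS](mx11_scalar (phi *m y)) -!raddfD /= addrA.
Qed.

(** Over a fixed [y] the map acts on the first coordinate alone, as an affine map of slope [c], so
    the one-dimensional formula applies under the integral over [y]. *)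
Lemma volume_upper_affine (R : realType) d (c a : R) (phi : 'rV_d)
    (S : set 'cV[R]_(1 + d)) : c != 0 -> measurable_cV S ->
  volume S = (`|c|%:E * volume
    [set v | S (block_mx c%:M phi 0 1%:M *m v + cons_cV a 0)%R])%E.
Proof.
move=> c0 mS; have mS' :=
  measurable_cV_affine (block_mx c%:M phi 0 1%:M) (cons_cV a 0) mS.
rewrite (volume_ysection mS) (volume_ysection mS').
rewrite -ge0_integralZl_EFin //; last exact: measurable_fun_ysection_cV.
apply: eq_integral => t _.
rewrite (lebesgue_measure_affine ((phi *m (\col_i tnth t i)) 0 0 + a) c0);
  last exact: measurable_ysection_cV.
congr (_ * lebesgue_measure _)%E; apply/seteqP; split=> x /=;
  by rewrite upper_cons_cV.
Qed.

Lemma volume_translation (R : realType) d (w : 'cV[R]_d) (S : set 'cV_d) :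
  measurable_cV S -> volume S = volume [set v | S (v + w)].
Proof.
elim: d w S => [|d IHd] w S mS.
  by congr volume; apply/seteqP; split=> v /=;
    rewrite (flatmx0 (v + w)) (flatmx0 v).
have -> : w = cons_cV (usubmx (w : 'cV_(1 + d)) 0 0) (dsubmx (w : 'cV_(1 + d))).
  by rewrite /cons_cV -mx11_scalar vsubmxK.
set a := usubmx _ _ _; set w' := dsubmx _.
(* The first coordinate is translated here, with slope 1 and no shear; the induction hypothesis
   translates each section in the other coordinates. *)
rewrite (volume_upper_affine a 0 (oner_neq0 R) mS) normr1 mul1e.
rewrite -scalar_mx_block.
have mS1 := measurable_cV_affine 1%:M (cons_cV a 0) mS.
rewrite !volume_xsection; apply: eq_integral => x _.
rewrite (IHd w'); last exact: (measurable_xsection_cV x mS1).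
congr volume; apply/seteqP; split=> y /=;
  by rewrite mul1mx (cons_cVD x a y w') cons_cVD addr0.
Qed.

(** The section at [x] is merely translated, by [psi *m x%:M]. *)
Lemma volume_lower (R : realType) d (psi : 'cV[R]_d) (S : set 'cV_(1 + d)) :
  measurable_cV S ->
  volume S = volume [set v | S (block_mx 1%:M 0 psi 1%:M *m v)].
Proof.
move=> mS; rewrite !volume_xsection; apply: eq_integral => x _.
rewrite (volume_translation (psi *m x%:M));
  last exact: (measurable_xsection_cV x mS).
congr volume; apply/seteqP; split=> y /=;
  by rewrite /cons_cV mul_block_col mul0mx addr0 !mul1mx addrC.
Qed.

(** The change of variables formula for [P]. It is established for shears and scalings of the first
    coordinate and is closed under products. *)
Definition volume_scaling (R : realType) d (P : 'M[R]_d) :=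
  P \in unitmx /\ forall S, measurable_cV S ->
    volume S = (`|\det P|%:E * volume [set v | S (P *m v)%R])%E.

Lemma measurable_cV_mulmx (R : realType) d e (P : 'M[R]_(d, e))
    (S : set 'cV_d) :
  measurable_cV S -> measurable_cV [set v | S (P *m v)].
Proof.
move=> /(measurable_cV_affine P 0); congr measurable_cV.
by apply/seteqP; split=> v /=; rewrite addr0.
Qed.

Lemma volume_scaling_mul (R : realType) d (P Q : 'M[R]_d) :
  volume_scaling P -> volume_scaling Q -> volume_scaling (P *m Q).
Proof.
move=> [uP sP] [uQ sQ]; split=> [|S mS]; first by rewrite unitmx_mul uP.
rewrite sP // sQ; last exact: measurable_cV_mulmx.
rewrite muleA -EFinM det_mulmx normrM; congr (_ * volume _)%E.
by apply/seteqP; split=> v /=; rewrite mulmxA.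
Qed.

Lemma volume_scaling_upper (R : realType) d (c : R) (phi : 'rV_d) : c != 0 ->
  volume_scaling (block_mx c%:M phi 0 1%:M : 'M[R]_(1 + d)).
Proof.
move=> c0; have detE : \det (block_mx c%:M phi 0 1%:M : 'M[R]_(1 + d)) = c.
  by rewrite det_ublock det1 mulr1 det_scalar1.
split=> [|S mS]; first by rewrite unitmxE detE unitfE.
rewrite detE (volume_upper_affine 0 phi c0 mS); congr (_ * volume _)%E.
by apply/seteqP; split=> v /=; rewrite /cons_cV raddf0 col_mx0 addr0.
Qed.

Lemma volume_scaling_lower (R : realType) d (psi : 'cV[R]_d) :
  volume_scaling (block_mx 1%:M 0 psi 1%:M : 'M[R]_(1 + d)).
Proof.
have detE : \det (block_mx 1%:M 0 psi 1%:M : 'M[R]_(1 + d)) = 1.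
  by rewrite det_lblock !det1 mulr1.
split=> [|S mS]; first by rewrite unitmxE detE unitr1.
by rewrite detE normr1 mul1e; exact: volume_lower.
Qed.

Lemma volume_scaling_delta (R : realType) d (v : 'cV[R]_(1 + d)) : v != 0 ->
  exists2 P, volume_scaling P & P *m v = delta_mx 0 0.
Proof.
have delta_cons : delta_mx 0 0 = cons_cV (1 : R) (0 : 'cV_d).
  rewrite /cons_cV; apply/matrixP => i j; rewrite !mxE; case: splitP => k ik.
    by rewrite !ord1 mxE eqxx andbT -val_eqE /= ik ord1.
  by rewrite mxE -val_eqE /= ik.
(* A lower shear clears [y] with the pivot [x], and a scaling then turns the pivot into 1. *)
have nz x (y : 'cV[R]_d) : x != 0 ->
    exists2 P, volume_scaling P & P *m cons_cV x y = delta_mx 0 0.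
  move=> x0; exists (block_mx (x^-1)%:M 0 0 1%:M *m
      block_mx 1%:M 0 (- x^-1 *: y) 1%:M).
    apply: volume_scaling_mul; last exact: volume_scaling_lower.
    by apply: volume_scaling_upper; rewrite invr_eq0.
  rewrite -mulmxA /cons_cV !mul_block_col !mul0mx !mul1mx !addr0 add0r.
  rewrite delta_cons /cons_cV -scalar_mxM mulVf // mul_mx_scalar.
  by rewrite scalerA mulrN mulfV // scaleN1r addNr.
have -> : v = cons_cV (usubmx v 0 0) (dsubmx v).
  by rewrite /cons_cV -mx11_scalar vsubmxK.
set x := usubmx v 0 0; set y := dsubmx v.
have [->|x0 _] := eqVneq x 0; last exact: nz.
have [->|y0 _] := eqVneq y 0; first by rewrite /cons_cV raddf0 col_mx0 eqxx.
have [k yk] : exists k, y k 0 != 0.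
  apply/existsP; apply: contraR y0; rewrite negb_exists => /forallP y0.
  by apply/eqP/matrixP => i j; rewrite ord1 [RHS]mxE; apply/eqP/negPn/y0.
have [P sP Pv] := nz _ y yk.
(* The first coordinate is 0, so an upper shear first copies the nonzero entry [y k 0] into it as a
   pivot. *)
exists (P *m block_mx 1%:M (delta_mx 0 k) 0 1%:M).
  by apply: volume_scaling_mul => //; apply: volume_scaling_upper;
    rewrite oner_neq0.
rewrite -mulmxA /cons_cV mul_block_col mul0mx !mul1mx raddf0 !add0r -rowE.
by rewrite -Pv /cons_cV; congr (_ *m col_mx _ _); rewrite [LHS]mx11_scalar mxE.
Qed.

(** * Zonotopes *)

Lemma zonotopeP (R : realType) d n (A : 'M[R]_(d, n)) (v : 'cV_d) :
  zonotope A v <->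
  exists2 t : 'cV_n, (forall i, 0 <= t i 0 <= 1) & v = A *m t.
Proof.
have E (t : 'I_n -> R) : \sum_i t i *: col i A = A *m (\col_i t i).
  apply/matrixP => i j; rewrite summxE !mxE; apply: eq_bigr => k _.
  by rewrite !mxE mulrC.
split=> [[t t01 ->]|[t t01 ->]].
  by exists (\col_i t i) => [i|]; rewrite ?mxE.
exists (fun i => t i 0) => //; rewrite E; congr (_ *m _).
by apply/matrixP => i j; rewrite mxE ord1.
Qed.

Lemma zonotope_mulmx (R : realType) d n (P : 'M[R]_d) (A : 'M[R]_(d, n)) :
  P \in unitmx -> [set v | zonotope (P *m A) (P *m v)] = zonotope A.
Proof.
move=> uP; apply/seteqP; split=> v /=; rewrite !zonotopeP => -[t t01 Pv];
  exists t => //; last by rewrite Pv mulmxA.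
by rewrite -(mulKmx uP v) Pv -mulmxA mulKmx.
Qed.

Lemma zonotope_zero_col (R : realType) d n (A : 'M[R]_(d, n)) j (v : 'cV_d) :
  zonotope A v <->
  exists2 s, 0 <= s <= 1 & zonotope (zero_col j A) (v - s *: col j A).
Proof.
have E (t : 'cV_n) : A *m t = zero_col j A *m t + t j 0 *: col j A.
  apply/matrixP => i k; rewrite ord1 !mxE (bigD1 j) //= addrC.
  rewrite [X in _ = X + _](bigD1 j) //= !mxE eqxx mul0r add0r mulrC.
  by congr (_ + _); apply: eq_bigr => l lj; rewrite mxE (negPf lj).
split.
  move/zonotopeP => [t t01 ->]; exists (t j 0) => //; rewrite E addrK.
  by apply/zonotopeP; exists t.
move=> [s s01 /zonotopeP [t t01 /(canRL (subrK _)) ->]]; apply/zonotopeP.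
(* The coefficient of the zeroed column has no effect there and may be overwritten by [s]. *)
exists (\col_i if i == j then s else t i 0) => [i|].
  by rewrite mxE; case: ifP.
rewrite E mxE eqxx; congr (_ + _); apply/matrixP => i k; rewrite !mxE.
by apply: eq_bigr => l _; rewrite !mxE ord1; case: ifP; rewrite ?mul0r.
Qed.

Lemma zonotope0 (R : realType) d n : zonotope (0 : 'M[R]_(d, n)) = [set 0].
Proof.
apply/seteqP; split=> v; rewrite zonotopeP.
  by move=> [t _ ->]; rewrite mul0mx.
by move=> ->; exists 0 => [i|]; rewrite ?mulmx0 // mxE lexx ler01.
Qed.

(** Induction on the number of nonzero columns. *)
Lemma zero_col_ind (R : realType) d n (Pr : 'M[R]_(d, n) -> Prop) :
  Pr 0 ->
  (forall A j, col j A != 0 -> Pr (zero_col j A) -> Pr A) -> forall A, Pr A.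
Proof.
move=> P0 PS A; have [m] := ubnP #|[set j | col j A != 0]%SET|.
elim: m A => // m IHm A; rewrite ltnS => Am.
have [j Aj|A0] := pickP (fun j => col j A != 0); last first.
  rewrite (_ : A = 0) //; apply/matrixP => i j.
  by move/negbFE/eqP/matrixP: (A0 j) => /(_ i 0); rewrite !mxE.
apply: (PS A j Aj); apply: IHm; apply: leq_trans Am.
apply: proper_card; apply/properP; split.
  apply/fintype.subsetP => k; rewrite !inE; apply: contraNneq => Ak.
  apply/eqP/matrixP => i l; rewrite !mxE; case: ifP => // _.
  by move/matrixP: Ak => /(_ i 0); rewrite !mxE.
exists j; rewrite !inE // negbK; apply/eqP/matrixP => i l.
by rewrite !mxE eqxx.
Qed.

(** * Polyhedra and measurability of zonotopes *)

Definition polyhedron (R : realType) d (s : seq ('rV[R]_d * R)) : set 'cV_d :=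
  [set v | forall c, c \in s -> (c.1 *m v) 0 0 <= c.2].

Lemma measurable_polyhedron (R : realType) d (s : seq ('rV[R]_d * R)) :
  measurable_cV (polyhedron s).
Proof.
elim: s => [|c s IHs].
  rewrite /measurable_cV (_ : [set _ | _] = setT) //.
  by apply/seteqP; split.
have mc : measurable_cV [set v | (c.1 *m v) 0 0 <= c.2].
  have dotE (t : d.-tuple R) :
      (c.1 *m (\col_i tnth t i)) 0 0 = \sum_j c.1 0 j * tnth t j.
    by rewrite mxE; apply: eq_bigr => j _; rewrite mxE.
  rewrite /measurable_cV -[X in measurable X]setTI.
  pose f (t : d.-tuple (measurableTypeR R)) := \sum_j c.1 0 j * tnth t j.
  rewrite (_ : [set _ | _] = f @^-1` [set` `]-oo, c.2]]); last first.
    by apply/seteqP; split=> t /=; rewrite in_itv /= dotE.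
  suff mf : measurable_fun setT f by exact: mf.
  apply: measurable_sum => j; apply: measurable_funM;
    first exact: measurable_cst.
  exact: measurable_tnth.
rewrite /measurable_cV (_ : [set _ | _] =
    [set t : d.-tuple (measurableTypeR R) |
      (c.1 *m (\col_i tnth t i)) 0 0 <= c.2] `&`
    [set t | polyhedron s (\col_i tnth t i)]); first exact: measurableI.
apply/seteqP; split=> t /=.
  move=> H; split=> [|c' c's]; first by apply: H; rewrite mem_head.
  by apply: H; rewrite inE c's orbT.
by move=> [H H'] c'; rewrite inE => /predU1P[->//|]; exact: H'.
Qed.

(* The constraint i0 reads 0 <= t, so the largest lower bound can be taken as a
   maximum starting at 0. *)
Lemma fourier_motzkin (R : realFieldType) (I : eqType) (s : seq I)
    (a b : I -> R) i0 :
  i0 \in s -> a i0 = -1 -> b i0 = 0 ->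
  (exists t, forall i, i \in s -> a i * t <= b i) <->
  (forall i, i \in s -> a i = 0 -> 0 <= b i) /\
  (forall i j, i \in s -> j \in s -> 0 < a i -> a j < 0 ->
     0 <= a i * b j - a j * b i).
Proof.
move=> i0s ai0 bi0; split=> [[t st]|[s0 sij]].
  split=> [i /st + ai0'|i j /st hi /st hj ai aj]; first by rewrite ai0' mul0r.
  rewrite subr_ge0 -lerN2 -!mulNr; apply: (@le_trans _ _ (- a j * (a i * t))).
    nra.
  nra.
exists (\big[Num.max/0]_(j <- s | a j < 0) (b j / a j)) => i si.
set t := \big[Num.max/0]_(j <- s | _) _.
have [ai|ai|ai] := ltgtP (a i) 0; last by rewrite ai mul0r s0.
  rewrite -ler_ndivrMl // mulrC.
  exact: (@le_bigmax_seq _ _ _ _ _ i (fun j => a j < 0) (fun j => b j / a j)).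
rewrite mulrC -ler_pdivlMr // /t big_seq_cond.
apply: (big_ind (fun x => x <= b i / a i)) => [|x y xi yi|j /andP[js aj]].
(* The starting value 0 of the maximum respects the upper bound of [i]: pairing [i] with [i0] gives
   [0 <= b i]. *)
- have := sij i i0 si i0s ai; rewrite ai0 bi0 mulr0 sub0r mulN1r opprK ltrN10.
  by move=> /(_ isT) bi; rewrite divr_ge0 // ltW.
- by rewrite ge_max xi yi.
have := sij _ _ si js ai aj; rewrite subr_ge0 => H.
by rewrite ler_ndivrMr // mulrAC ler_pdivrMr // [b i * _]mulrC [b j * _]mulrC.
Qed.

(** The sum is the projection along [t] of a polyhedron of pairs (t, x); Fourier-Motzkin elimination
    removes [t]. *)
Lemma polyhedron_add_segment (R : realType) d (s : seq ('rV[R]_d * R))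
    (v : 'cV_d) :
  exists s', polyhedron s' =
    [set x | exists2 t, 0 <= t <= 1 & polyhedron s (x - t *: v)].
Proof.
(* (alpha, (u, beta)) in s3 stands for the constraint alpha t + u x <= beta. *)
pose s3 : seq (R * ('rV[R]_d * R)) := [:: (1, (0, 1)), (-1, (0, 0)) &
  [seq (- (c.1 *m v) 0 0, c) | c <- s]].
pose b (x : 'cV[R]_d) (c : R * ('rV[R]_d * R)) := c.2.2 - (c.2.1 *m x) 0 0.
have segmentP x : (exists2 t, 0 <= t <= 1 & polyhedron s (x - t *: v)) <->
    exists t, forall c, c \in s3 -> c.1 * t <= b x c.
  have E t c : (- (c.1 *m v) 0 0 * t <= b x (0, c)) =
      ((c.1 *m (x - t *: v)) 0 0 <= c.2).
    rewrite /b /= mulmxBr -scalemxAr !mxE lerBrDr mulNr [_ * t]mulrC.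
    by congr (_ <= _); rewrite addrC.
  split=> [[t /andP[t0 t1] Pt]|[t Pt]]; exists t.
  - move=> c; rewrite !inE => /or3P[/eqP->|/eqP->|/mapP[c' c's ->]].
    + by rewrite /b mul0mx mxE subr0 mul1r.
    + by rewrite /b mul0mx mxE subr0 mulN1r oppr_le0.
    + by rewrite (E t c'); exact: Pt.
  - have := Pt (1, (0, 1)); have := Pt (-1, (0, 0)).
    rewrite !inE !eqxx orbT /= /b !mul0mx !mxE !subr0 mul1r mulN1r oppr_le0.
    by move=> -> // ->.
  - move=> c cs; rewrite -E; apply: (Pt (_, _)).
    by rewrite !inE map_f ?orbT.
have ks : (-1, (0, 0)) \in s3 by rewrite !inE eqxx orbT.
clearbody s3.
(* The constraints free of [t], followed by the positive combination cancelling [t] for each pair of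
   an upper and a lower bound. *)
exists ([seq c.2 | c <- s3 & c.1 == 0] ++
  [seq (c.1 *: c'.2.1 - c'.1 *: c.2.1, c.1 * c'.2.2 - c'.1 * c.2.2) |
    c <- [seq c <- s3 | 0 < c.1], c' <- [seq c <- s3 | c.1 < 0]]).
apply/seteqP; split=> x /=.
  move=> Px; apply/segmentP/(fourier_motzkin (b := b x) ks) => //.
    by rewrite /b mul0mx mxE subr0.
  split=> [c cs c0|c c' cs c's c0 c'0].
    rewrite subr_ge0; apply: Px; rewrite mem_cat map_f //.
    by rewrite mem_filter c0 eqxx.
  have := Px (c.1 *: c'.2.1 - c'.1 *: c.2.1, c.1 * c'.2.2 - c'.1 * c.2.2).
  rewrite mem_cat allpairs_f ?orbT ?mem_filter ?c0 ?c'0 // => /(_ isT) /=.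
  rewrite mulmxBl -!scalemxAl /b !mxE; lra.
move=> /segmentP/(fourier_motzkin (b := b x) ks) [] //.
  by rewrite /b mul0mx mxE subr0.
move=> H0 H1 c; rewrite mem_cat => /orP[/mapP[c']|/allpairsP[[c' c''] /= []]].
  by rewrite mem_filter => /andP[/eqP c'0 c's] ->; rewrite -subr_ge0; exact: H0.
rewrite !mem_filter => /andP[c'0 c's] /andP[c''0 c''s] -> /=.
have := H1 _ _ c's c''s c'0 c''0.
rewrite mulmxBl -!scalemxAl /b !mxE; lra.
Qed.

(** The origin is cut out by the inequalities [v i 0 <= 0] and [- v i 0 <= 0], and each nonzero
    column adds a segment. *)
Lemma zonotope_polyhedron (R : realType) d n (A : 'M[R]_(d, n)) :
  exists s, polyhedron s = zonotope A.
Proof.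
elim/zero_col_ind: A => [|A j _ [s sA]].
  exists ([seq (delta_mx 0 i, 0) | i <- enum 'I_d] ++
          [seq (- delta_mx 0 i, 0) | i <- enum 'I_d]).
  rewrite zonotope0; apply/seteqP; split=> v /=; last first.
    by move=> -> c; rewrite mem_cat mulmx0 mxE => /orP[]/mapP[i _ ->].
  move=> Hv; apply/matrixP => i j; rewrite ord1 !mxE.
  have dotE : ((delta_mx 0 i : 'rV_d) *m v) 0 0 = v i 0 by rewrite -rowE mxE.
  apply/eqP; rewrite eq_le; apply/andP; split.
    by rewrite -dotE; apply: (Hv (_, _)); rewrite mem_cat map_f ?mem_enum.
  have dotNE : ((- delta_mx 0 i : 'rV_d) *m v) 0 0 = - v i 0.
    by rewrite mulNmx mxE dotE.
  rewrite -oppr_le0 -dotNE; apply: (Hv (_, _)).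
  by rewrite mem_cat [X in _ || X]map_f ?mem_enum ?orbT.
have [s' s'E] := polyhedron_add_segment s (col j A).
exists s'; rewrite s'E; apply/seteqP; split=> v /=; rewrite sA => Hv;
  exact/(zonotope_zero_col _ j).
Qed.

Lemma measurable_zonotope (R : realType) d n (A : 'M[R]_(d, n)) :
  measurable_cV (zonotope A).
Proof.
by have [s <-] := zonotope_polyhedron A; exact: measurable_polyhedron.
Qed.

(** * Sections along the first axis *)

Lemma lebesgue_measure_is_interval (R : realType) (I : set R) :
  is_interval I -> has_inf I -> has_sup I ->
  lebesgue_measure (I : set (measurableTypeR R)) = (sup I - inf I)%:E.
Proof.
move=> /is_intervalP IE [[x Ix] lI] [_ uI].
rewrite [in LHS]IE lebesgue_measure_itv /Rhull (asboolT lI) (asboolT uI) /=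
  lte_fin -EFinB.
have ix : inf I <= x by apply: ge_inf.
have xs : x <= sup I by apply: ub_le_sup.
by case: ltgtP (le_trans ix xs) => // ->; rewrite subrr.
Qed.

(** The sum is again an interval, and [sup] and [inf] are additive. Nonemptiness, contained in
    [has_inf], matters: an empty section stays empty. *)
Lemma lebesgue_measure_add_segment (R : realType) (I : set R) :
  is_interval I -> has_inf I -> has_sup I ->
  lebesgue_measure
    ([set x + s | x in I & s in `[0, 1]] : set (measurableTypeR R)) =
  (lebesgue_measure (I : set (measurableTypeR R)) + 1)%E.
Proof.
move=> iI infI supI; set U := [set` `[0, 1]] : set R; set J := image2 _ _ _.
have U01 s : U s = (0 <= s <= 1) by rewrite /U /= in_itv.
have infU : has_inf U.
  split; first by exists 0; rewrite U01 lexx ler01.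
  by exists 0 => s; rewrite U01 => /andP[].
have supU : has_sup U.
  split; first by exists 0; rewrite U01 lexx ler01.
  by exists 1 => s; rewrite U01 => /andP[].
have infJ : has_inf J.
  case: infI infU => [[x Ix] [a Ia]] [[s Us] [b Ub]]; split;
    first by exists (x + s), x => //; exists s.
  by exists (a + b) => _ [y Iy [r Ur <-]]; rewrite lerD ?Ia ?Ub.
have supJ : has_sup J.
  case: supI supU => [[x Ix] [a Ia]] [[s Us] [b Ub]]; split;
    first by exists (x + s), x => //; exists s.
  by exists (a + b) => _ [y Iy [r Ur <-]]; rewrite lerD ?Ia ?Ub.
have iJ : is_interval J.
  move=> _ _ [x Ix [s + <-]] [y Iy [r + <-]] z /andP[xz zy].
  rewrite !U01 => /andP[s0 s1] /andP[r0 r1].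
  (* Up to [x + 1] the point [z] is reached from [x]; beyond that, [z - 1] lies between [x] and
     [y]. *)
  have [zx|xz1] := leP z (x + 1).
    exists x => //; exists (z - x); last by rewrite addrC subrK.
    by rewrite U01; apply/andP; split; lra.
  exists (z - 1); last by exists 1; rewrite ?U01 ?lexx ?ler01 ?subrK.
  by apply: (iI x y) => //; apply/andP; split; lra.
rewrite !lebesgue_measure_is_interval // sup_sumE // inf_sumE // -EFinD.
rewrite /U inf_itvcc ?sup_itvcc ?ler01 //; congr EFin; ring.
Qed.

Lemma zonotope_section_interval (R : realType) d n (A : 'M[R]_(1 + d, n)) y :
  is_interval [set x | zonotope A (cons_cV x y)].
Proof.
move=> x1 x2 /= /zonotopeP[t1 t101 E1] /zonotopeP[t2 t201 E2] z /andP[xz zx].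
(* By convexity [t1] and [t2] are interpolated with weight [l], the relative position of [z]; equal
   endpoints are set apart because [l] divides by [x2 - x1]. *)
have [x12|x12] := eqVneq x1 x2.
  have -> : z = x1 by apply/le_anti; rewrite xz x12 zx.
  by apply/zonotopeP; exists t1.
have x12' : 0 < x2 - x1 by rewrite subr_gt0 lt_neqAle x12 (le_trans xz zx).
pose l := (z - x1) / (x2 - x1).
have l0 : 0 <= l by rewrite divr_ge0 ?(ltW x12') // subr_ge0.
have l1 : l <= 1 by rewrite ler_pdivrMr // mul1r lerD2r.
apply/zonotopeP; exists (t1 + l *: (t2 - t1)).
  move=> i; have /andP[? ?] := t101 i; have /andP[? ?] := t201 i.
  by rewrite !mxE; apply/andP; split; nra.
rewrite mulmxDr -scalemxAr mulmxBr -E1 -E2 /cons_cV opp_col_mx add_col_mx.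
rewrite scale_col_mx add_col_mx subrr scaler0 addr0; congr col_mx.
apply/matrixP => i j; rewrite !ord1 !mxE eqxx !mulr1n.
by rewrite /l -mulrA mulVf ?gt_eqF // mulr1 addrC subrK.
Qed.

Lemma zonotope_section_bounded (R : realType) d n (A : 'M[R]_(1 + d, n)) y x :
  zonotope A (cons_cV x y) -> `|x| <= \sum_j `|A (lshift d 0) j|.
Proof.
move=> /zonotopeP[t t01] /matrixP/(_ (lshift d 0) 0).
rewrite col_mxEu !mxE eqxx mulr1n => ->.
apply: le_trans (ler_norm_sum _ _ _) _; apply: ler_sum => j _.
have /andP[t0 t1] := t01 j.
by rewrite normrM ler_piMr // ger0_norm.
Qed.

(** Identifies the points [y] over which the section is nonempty. *)
Lemma zonotope_projection (R : realType) d n (A : 'M[R]_(1 + d, n)) y :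
  zonotope (dsubmx A) y <-> exists x, zonotope A (cons_cV x y).
Proof.
rewrite zonotopeP; split=> [[t t01 ->]|[x /zonotopeP[t t01 E]]].
  exists ((usubmx A *m t) 0 0); apply/zonotopeP; exists t => //.
  by rewrite /cons_cV -mx11_scalar -mul_col_mx vsubmxK.
exists t => //; move: E; rewrite -{1}(vsubmxK A) mul_col_mx.
by move=> /eq_col_mx[].
Qed.

Lemma row'0_dsubmx (T : Type) d n (A : 'M[T]_(1 + d, n)) :
  row' (0 : 'I_d.+1) A = dsubmx A.
Proof.
apply/matrixP => i j; rewrite !mxE; congr (A _ j); exact/val_inj.
Qed.

Lemma volume_zonotope_zero_col (R : realType) d n (A : 'M[R]_(1 + d, n)) j :
  col j A = delta_mx 0 0 ->
  volume (zonotope A) =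
  (volume (zonotope (zero_col j A)) + volume (zonotope (dsubmx A)))%E.
Proof.
move=> Aj; have cons_delta (s : R) : s *: delta_mx 0 0 = cons_cV s (0 : 'cV_d).
  apply/matrixP => i k; rewrite !mxE !ord1 eqxx andbT.
  by case: splitP => l il;
    rewrite mxE ?ord1 ?eqxx -val_eqE /= il ?ord1 ?mulr1 ?mulr0.
have dA : dsubmx A = dsubmx (zero_col j A).
  apply/matrixP => i k; rewrite !mxE; case: eqP => // ->.
  by have /matrixP/(_ (rshift 1 i) 0) := Aj; rewrite !mxE.
have mS := measurable_zonotope (zero_col j A).
rewrite (volume_ysection (measurable_zonotope A)) (volume_ysection mS).
(* [Y] is the base over which sections are nonempty. Each of them grows by 1, so the indicator of
   [Y] is the increment under the integral. *)
pose Y := [set t : d.-tuple (measurableTypeR R) |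
  zonotope (dsubmx A) (\col_i tnth t i)].
have mY : measurable Y by exact: (measurable_zonotope (dsubmx A)).
have -> : volume (zonotope (dsubmx A)) =
    (\int[lebesgue_tuple R d]_t (\1_Y t)%:E)%E.
  by rewrite integral_indic // setIT.
rewrite -ge0_integralD //; last 2 first.
- exact: measurable_fun_ysection_cV.
- exact/measurable_EFinP/measurable_indic.
apply: eq_integral => t _; set y := \col_i tnth t i.
set I := [set x | zonotope (zero_col j A) (cons_cV x y)].
have -> : [set x | zonotope A (cons_cV x y)] =
    [set x + s | x in I & s in `[0, 1]].
  have E (x s : R) : cons_cV x y - s *: col j A = cons_cV (x - s) y.
    by rewrite Aj -scaleNr cons_delta cons_cVD addr0.
  apply/seteqP; split=> x /=.
    move=> /(zonotope_zero_col _ j)[s s01]; rewrite E => Ixs.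
    by exists (x - s) => //; exists s; rewrite /= ?in_itv ?subrK.
  move=> [x' Ix' [s /=]]; rewrite in_itv /= => s01 <-.
  by apply/(zonotope_zero_col _ j); exists s => //; rewrite E addrK.
rewrite indicE; have [Yt|nYt] := boolP (t \in Y).
  move: Yt; rewrite in_setE /Y /= dA => /zonotope_projection[x Ix].
  rewrite lebesgue_measure_add_segment //.
  - exact: zonotope_section_interval.
  - split; first by exists x.
    exists (- \sum_k `|zero_col j A (lshift d 0) k|) => x' Ix'.
    by have := zonotope_section_bounded Ix'; rewrite ler_norml => /andP[].
  - split; first by exists x.
    exists (\sum_k `|zero_col j A (lshift d 0) k|) => x' Ix'.
    by have := zonotope_section_bounded Ix'; rewrite ler_norml => /andP[].
have I0 : I = set0.
  apply/seteqP; split=> x //= Ix; move: nYt; rewrite notin_setE /Y /= dA.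
  by apply; apply/zonotope_projection; exists x.
rewrite I0 (_ : [set _ + _ | _ in _ & _ in _] = set0) ?measure0 ?adde0 //.
by apply/seteqP; split=> x //= [].
Qed.

(** A point is a degenerate box; in dimension 0 the empty product gives volume 1. *)
Lemma volume_singleton0 (R : realType) d :
  volume [set (0 : 'cV[R]_d)] = ((d == 0%N)%:R)%:E.
Proof.
rewrite /volume; transitivity ((\prod_(i < d) (0 - 0 : R))%:E); last first.
  by rewrite subr0; case: d => [|d]; rewrite ?big_ord0 // big_ord_recl mul0r.
rewrite -lebesgue_tuple_box //; congr (lebesgue_tuple _ _ _).
apply/seteqP; split=> t /=.
  by move=> /matrixP t0 i; have := t0 i 0; rewrite !mxE in_itv /= => ->;
    rewrite lexx.
move=> t0; apply/matrixP => i j; have := t0 i; rewrite !mxE in_itv /=.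
by move/le_anti.
Qed.

(** * The volume of a zonotope in terms of minors *)

Lemma volume_zonotope (R : realType) d n (A : 'M[R]_(d, n)) :
  volume (zonotope A) = (minor_sum A / d`!%:R)%:E.
Proof.
(* The outer induction on [d] handles the matrix without row 0, the inner one on nonzero columns the
   matrix with column [j] zeroed. *)
elim: d A => [|d IHd] A.
  by rewrite (flatmx0 A) zonotope0 volume_singleton0 minor_sum0 fact0 divr1.
elim/zero_col_ind: A => [|A j Aj IHA].
  by rewrite zonotope0 volume_singleton0 minor_sum0 mul0r.
have [P [uP sP] PA] := volume_scaling_delta (Aj : (col j A : 'cV_(1 + d)) != 0).
have detP : `|\det P| != 0 by rewrite normr_eq0 -unitfE -unitmxE.
have volP B : volume (zonotope (P *m B)) =
    (`|\det P|%:E * volume (zonotope B))%E.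
  by rewrite (sP _ (measurable_zonotope _)) zonotope_mulmx.
have PAj : col j (P *m A) = delta_mx 0 0.
  by rewrite -PA; apply/matrixP => i k; rewrite !mxE; apply: eq_bigr => l _;
    rewrite mxE.
have zP : zero_col j (P *m A) = P *m zero_col j A.
  apply/matrixP => i k; rewrite !mxE; case: ifP => kj.
    by rewrite big1 // => l _; rewrite mxE kj mulr0.
  by apply: eq_bigr => l _; rewrite mxE kj.
have : volume (zonotope (P *m A)) = (`|\det P| * (minor_sum A / d.+1`!%:R))%:E.
  rewrite (volume_zonotope_zero_col PAj) zP volP IHA -row'0_dsubmx IHd -EFinM
    -EFinD.
  congr EFin; rewrite mulrA -minor_sum_mulmx [in RHS]mulrA.
  rewrite -[in RHS]minor_sum_mulmx.
  rewrite (minor_sum_zero_col PAj) zP mulrDl; congr (_ + _).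
  (* The factor d + 1 of the recurrence turns (d + 1)! into d!. *)
  by rewrite -[minor_sum _ *+ _]mulr_natr factS natrM invfM mulrA mulfK
    ?pnatr_eq0.
(* Dividing by the nonzero [|\det P|] returns from [P *m A] to [A]. *)
rewrite volP => /(congr1 (mule (`|\det P|^-1)%:E)) /=.
by rewrite muleA -!EFinM mulKf // mulVf // mul1e.
Qed.

Theorem theorem3 (R : realType) (d n : nat) (M : 'M[int]_(d, n)) :
  unimodular M ->
  let toR := intr : int -> R in
  let L := M *m M^T in
  (exists lambda : d.-tuple R,
     eigenvalues_with_multiplicity (map_mx toR L) lambda) /\
  (forall lambda : d.-tuple R,
     eigenvalues_with_multiplicity (map_mx toR L) lambda ->
     volume (zonotope (map_mx toR M)) = volume (zonotope (map_mx toR L)) /\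
     volume (zonotope (map_mx toR L)) = (\prod_(a <- lambda) a)%:E).
Proof.
move=> [_ /det_colsub_unimodular uM] toR L.
set A := map_mx toR M; set LR := map_mx toR L.
have LE : LR = A *m A^T by rewrite /LR map_mxM map_trmx.
have uA (f : 'I_d -> 'I_n) : \det (colsub f A) \in [:: -1; 0; 1].
  rewrite -map_mxsub det_map_mx; move: (uM f); rewrite !inE.
  by move=> /or3P[] /eqP-> /=; rewrite ?rmorphN1 ?rmorph0 ?rmorph1 eqxx ?orbT.
have fact_neq0 : d`!%:R != 0 :> R by rewrite pnatr_eq0 -lt0n fact_gt0.
have volA : volume (zonotope A) = (\det LR)%:E.
  by rewrite volume_zonotope minor_sum_unimodular // -LE mulfK.
have volL : volume (zonotope LR) = (\det LR)%:E.
  (* [LR] is viewed as [LR] times the identity, whose minor sum is d!. *)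
  rewrite volume_zonotope -[LR in minor_sum LR]mulmx1 minor_sum_mulmx.
  rewrite (minor_sum_unimodular (@det_colsub1 R d)) trmx1 mul1mx det1 mul1r
    mulfK //.
  (* The determinant is nonnegative because d! times it is the minor sum of [A]. *)
  congr EFin; apply: ger0_norm; have := minor_sum_ge0 A.
  by rewrite minor_sum_unimodular // -LE pmulr_lge0 // ltr0n fact_gt0.
split; first by apply: char_poly_symmetric_split; rewrite LE trmx_mul trmxK.
move=> lambda Llambda; rewrite volA volL; split=> //; congr EFin.
(* Comparing constant coefficients of the characteristic polynomial: both sides carry the factor
   (-1)^d, which is cancelled. *)
have := char_poly_det LR; rewrite Llambda -horner_coef0 horner_prod.
under eq_bigr do rewrite hornerXsubC sub0r -mulN1r.
rewrite big_split /= big_const_seq count_predT size_tuple iter_mulr_1.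
by move=> /(mulfI (expf_neq0 _ _))->.
Qed.
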